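(* Let $(V,V^+,\Vert\cdot\Vert)$ be a complete order smooth $\infty$-normed space and let $W$ be a closed subspace of $V$. If $W$ is an $M$-ideal in $V$, then the following are equivalent: (i) $(W,W^+,\Vert\cdot\Vert)$ is an order smooth $\infty$-normed space; (ii) for every $f\in W^{*+}$ there is $g\in V^{*+}$ such that $g|_W=f$; (iii) $\varphi_{W^\perp}(V^{*+})=\overline{\varphi_{W^\perp}(V^{*+})}^{w^*}$; (iv) $\Vert f\Vert=\sup\{f(w): w\in W^+\cap W_1\}$ for all $f\in W^{*+}$.
   Context: A cone in a real vector space is a set $C$ with $\lambda x+y\in C$ for $x,y\in C$, $\lambda\ge 0$; it is proper if $C\cap(-C)=\{0\}$. For a cone $V^+$ in $V$, write $x\le y$ if $y-x\in V^+$; $V^+$ is generating if $V=V^+-V^+$. A real normed space $V$ with a cone $V^+$ is an order smooth $\infty$-normed space if $V^+$ is proper, generating and norm closed, and: $(O.\infty.1)$: $u\le v\le w$ implies $\Vert v\Vert\le\max\{\Vert u\Vert,\Vert w\Vert\}$; $(O.\infty.2)$: for every $v\in V$ and $\epsilon>0$ there are $v_1,v_2\in V^+$ with $v=v_1-v_2$ and $\max\{\Vert v_1\Vert,\Vert v_2\Vert\}<\Vert v\Vert+\epsilon$. For a closed subspace $W$ of $V$: $W^+=W\cap V^+$; $W_1$ is the closed unit ball of $W$; $V^{*+}=\{f\in V^*: f(v)\ge0\ \forall v\in V^+\}$ and $W^{*+}=\{f\in W^*:f(w)\ge0\ \forall w\in W^+\}$; $W^\perp=\{f\in V^*:f|_W=0\}$;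 $\varphi_{W^\perp}:V^*\to V^*/W^\perp$ is the quotient map, and the weak$^*$ topology on $V^*/W^\perp$ is the one coming from its identification with $W^*$. A closed subspace $Y$ of a Banach space $X$ is an $L$-summand if there is a subspace $Y'$ of $X$ with $X=Y\oplus_1 Y'$, i.e. $X$ is the algebraic direct sum of $Y$ and $Y'$ and $\Vert y+y'\Vert=\Vert y\Vert+\Vert y'\Vert$ for all $y\in Y$, $y'\in Y'$. A closed subspace $W$ of a Banach space $V$ is an $M$-ideal if $W^\perp$ is an $L$-summand in $V^*$. *)

(* Defs.v *)
From HB Require Import structures.
From mathcomp Require Import all_boot all_order all_algebra.
From mathcomp Require Import all_classical all_reals all_analysis.

Set Implicit Arguments.
Unset Strict Implicit.
Unset Printing Implicit Defensive.

Import Order.TTheory GRing.Theory Num.Theory.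
Import numFieldNormedType.Exports.

Local Open Scope classical_set_scope.
Local Open Scope quotient_scope.
Local Open Scope ring_scope.

Section order_smooth.
Context {R : realType} {V : normedModType R}.
Implicit Type C : set V.

Definition cone C :=
  forall (l : R) (x y : V), 0 <= l -> C x -> C y -> C (l *: x + y).

Definition proper_cone C := C `&` -%R @` C = [set 0].

Definition generating_cone C :=
  [set: V] = [set v | exists v1 v2, [/\ C v1, C v2 & v = v1 - v2]].

Definition cone_le C (x y : V) := C (y - x).

Definition order_smooth_oo1 C := forall u v w : V,
  cone_le C u v -> cone_le C v w -> `|v| <= Num.max `|u| `|w|.

Definition order_smooth_oo2 C := forall (v : V) (e : R), 0 < e ->
  exists v1 v2 : V,
    [/\ C v1, C v2, v = v1 - v2 & Num.max `|v1| `|v2| < `|v| + e].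

Record order_smooth_oo_normed C : Prop := OrderSmoothOoNormed {
  order_smooth_cone : cone C;
  order_smooth_proper : proper_cone C;
  order_smooth_generating : generating_cone C;
  order_smooth_closed : closed C;
  order_smooth_le_max : order_smooth_oo1 C;
  order_smooth_decomposition : order_smooth_oo2 C }.

End order_smooth.

Section sub_space.
Context {R : realType} {V : normedModType R}.

(* A linear subspace, given by its membership predicate, as a normed space
   with the norm inherited from V. *)
Definition sub_space (W : submodClosed V) : Type := {x : V | x \in W}.

Variable W : submodClosed V.

HB.instance Definition _ := SubType.on (sub_space W).
HB.instance Definition _ := Choice.on (sub_space W).
HB.instance Definition _ := [SubChoice_isSubLmodule of sub_space W by <:].

Let sub_norm (x : sub_space W) : R := `|val x|.

Let ler_sub_normD x y : sub_norm (x + y) <= sub_norm x + sub_norm y.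
Proof. exact: ler_normD. Qed.

Let sub_normZ (l : R) x : sub_norm (l *: x) = `|l| * sub_norm x.
Proof. exact: normrZ. Qed.

Let sub_norm_eq0 x : sub_norm x = 0 -> x = 0.
Proof. by move=> x0; apply: val_inj; exact: normr0_eq0. Qed.

HB.instance Definition _ := Lmodule_isNormed.Build R (sub_space W)
  ler_sub_normD sub_normZ sub_norm_eq0.

Definition sub_cone (C : set V) : set (sub_space W) := val @^-1` C.

Lemma sub_space_normE (x : sub_space W) : `|x| = `|val x|.
Proof. by []. Qed.

Lemma val_sub_space_continuous : continuous (val : sub_space W -> V).
Proof.
apply: bounded_linear_continuous; apply/linear_boundedP.
by near=> r => x; rewrite -sub_space_normE ler_peMl.
Unshelve. all: by end_near. Qed.

End sub_space.

Section dual_space.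
Context {R : realType} (V : normedModType R).

Definition dual_pred : {pred V -> R^o} :=
  fun f => `[< linear f /\ continuous f >].

Lemma dual_pred_submod_closed : submod_closed dual_pred.
Proof.
split.
  by apply/asboolP; split=> [a x y|x]; [rewrite /= scaler0 addr0|exact: cvg_cst].
move=> a f g /asboolP[lf cf] /asboolP[lg cg]; apply/asboolP; split.
  move=> b x y; rewrite !fctE lf lg !scalerDr !scalerA [b * a]mulrC.
  by rewrite addrACA.
by move=> x; apply: cvgD; [apply: cvgZr; exact: cf|exact: cg].
Qed.

HB.instance Definition _ :=
  GRing.isSubmodClosed.Build R (V -> R^o) dual_pred dual_pred_submod_closed.

Definition dual_space : Type := {f : V -> R^o | f \in dual_pred}.

HB.instance Definition _ := SubType.on dual_space.
HB.instance Definition _ := Choice.on dual_space.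
HB.instance Definition _ := [SubChoice_isSubLmodule of dual_space by <:].

Definition dual_fun (f : dual_space) : V -> R^o := val f.

Lemma dual_fun_linear (f : dual_space) : linear (dual_fun f).
Proof. by have /asboolP[] := valP f. Qed.

HB.instance Definition _ (f : dual_space) :=
  GRing.isLinear.Build R V R^o *:%R (dual_fun f) (dual_fun_linear f).

Lemma dual_fun_continuous (f : dual_space) : continuous (dual_fun f).
Proof. by have /asboolP[] := valP f. Qed.

Definition dual_norm (f : dual_space) : R :=
  sup [set `|dual_fun f x| | x in [set x : V | `|x| <= 1]].

Let dual_ball (f : dual_space) :=
  [set `|dual_fun f x| | x in [set x : V | `|x| <= 1]].

Let dual_ball_has_sup f : has_sup (dual_ball f).
Proof.
split; first by exists `|dual_fun f 0|, 0 => //=; rewrite normr0 ler01.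
have := @dual_fun_continuous f.
move=> /linear_bounded_continuous /linear_boundedP /pinfty_ex_gt0[r r0 fr].
exists r => _ [x /= x1 <-]; apply: le_trans (fr x) _.
by rewrite ler_piMr// ltW.
Qed.

Lemma ler_dual_norm1 (f : dual_space) (x : V) :
  `|x| <= 1 -> `|dual_fun f x| <= dual_norm f.
Proof.
by move=> x1; apply: (ub_le_sup (dual_ball_has_sup f).2); exists x.
Qed.

Lemma dual_norm_le (f : dual_space) (M : R) :
  (forall x : V, `|x| <= 1 -> `|dual_fun f x| <= M) -> dual_norm f <= M.
Proof.
by move=> fM; apply: (ge_sup (dual_ball_has_sup f).1) => _ [x x1 <-]; exact: fM.
Qed.

Lemma ler_dual_norm (f : dual_space) (x : V) :
  `|dual_fun f x| <= dual_norm f * `|x|.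
Proof.
have [->|x0] := eqVneq x 0; first by rewrite linear0 !normr0 mulr0.
have x_gt0 : 0 < `|x| by rewrite normr_gt0.
have := @ler_dual_norm1 f (`|x|^-1 *: x).
rewrite normrZ normfV normr_id mulVf ?normr_eq0// => /(_ (lexx _)).
by rewrite linearZ normrZ normfV normr_id ler_pdivrMl// mulrC.
Qed.

Let ler_dual_normD f g : dual_norm (f + g) <= dual_norm f + dual_norm g.
Proof.
apply: dual_norm_le => x x1; apply: le_trans (ler_normD _ _) _.
by apply: lerD; exact: ler_dual_norm1.
Qed.

Let ler_dual_normZ (l : R) f : dual_norm (l *: f) <= `|l| * dual_norm f.
Proof.
apply: dual_norm_le => x x1; rewrite /dual_fun/= normrZ ler_wpM2l//.
exact: ler_dual_norm1.
Qed.

Let dual_normZ (l : R) f : dual_norm (l *: f) = `|l| * dual_norm f.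
Proof.
apply/eqP; rewrite eq_le ler_dual_normZ/=.
have [->|l0] := eqVneq l 0.
  rewrite normr0 mul0r; apply: le_trans (ler_dual_norm1 (0 *: f) (x := 0) _) => //.
  by rewrite normr0 ler01.
rewrite -ler_pdivlMl ?normr_gt0// -normfV.
by rewrite -{1}[f](scalerK l0) ler_dual_normZ.
Qed.

Let dual_norm_eq0 f : dual_norm f = 0 -> f = 0.
Proof.
move=> f0; apply/val_inj/funext => x; apply/eqP; rewrite -normr_le0.
by have := ler_dual_norm f x; rewrite f0 mul0r.
Qed.

HB.instance Definition _ := Lmodule_isNormed.Build R dual_space
  ler_dual_normD dual_normZ dual_norm_eq0.

End dual_space.
Arguments dual_pred {R} V.

Coercion dual_fun : dual_space >-> Funclass.

Section dual_cone.
Context {R : realType} {V : normedModType R}.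

Definition dual_cone (C : set V) : set (dual_space V) :=
  [set f | forall v, C v -> 0 <= f v].

Definition weak_star : Type :=
  initial_topology (fun f : dual_space V => (f : {ptws V -> R^o})).

HB.instance Definition _ := Topological.on weak_star.

End dual_cone.
Arguments weak_star {R} V.

Section annihilator.
Context {R : realType} {V : normedModType R} (W : submodClosed V).

Lemma dual_restr_subproof (f : dual_space V) :
  (fun w : sub_space W => f (val w)) \in dual_pred (sub_space W).
Proof.
apply/asboolP; split=> [a x y|x]; first exact: dual_fun_linear.
apply: continuous_comp; first exact: val_sub_space_continuous.
exact: dual_fun_continuous.
Qed.

Definition dual_restr (f : dual_space V) : dual_space (sub_space W) :=
  exist _ (fun w : sub_space W => f (val w)) (dual_restr_subproof f).

Definition annihilator : {pred dual_space V} :=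
  fun f => `[< forall w, w \in W -> f w = 0 >].

Lemma annihilator_submod_closed : submod_closed annihilator.
Proof.
split; first exact/asboolP.
move=> a f g /asboolP f0 /asboolP g0; apply/asboolP => w wW.
by rewrite [LHS](_ : _ = a * dual_fun f w + dual_fun g w)// f0// g0// mulr0 addr0.
Qed.

HB.instance Definition _ := GRing.isSubmodClosed.Build R (dual_space V)
  annihilator annihilator_submod_closed.

Definition annihilator_quot : Type := {ideal_quot annihilator}.

HB.instance Definition _ := EqQuotient.on annihilator_quot.

Definition annihilator_pi : dual_space V -> annihilator_quot :=
  \pi_annihilator_quot.

Lemma annihilator_pi_eq (f g : dual_space V) :
  (annihilator_pi f == annihilator_pi g) = (dual_restr f == dual_restr g).
Proof.
rewrite /annihilator_pi -Quotient.idealrBE.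
apply/asboolP/eqP => [fg|/(congr1 val)/= fg w wW].
  apply/val_inj/funext => w; apply/eqP; rewrite -subr_eq0.
  by apply/eqP/fg; exact: (valP w).
have /= fgw := congr1 (fun h => h (exist _ w wW)) fg.
by apply/eqP; rewrite subr_eq0; apply/eqP.
Qed.

Definition annihilator_quot_restr (q : annihilator_quot) :
  dual_space (sub_space W) := dual_restr (repr q).

Lemma annihilator_quot_restrE (f : dual_space V) :
  annihilator_quot_restr (annihilator_pi f) = dual_restr f.
Proof.
apply/eqP; rewrite -annihilator_pi_eq.
by apply/eqP; rewrite /annihilator_pi reprK.
Qed.

Lemma annihilator_quot_restr_inj : injective annihilator_quot_restr.
Proof.
move=> p q /eqP; rewrite -annihilator_pi_eq => /eqP.
by rewrite /annihilator_pi !reprK.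
Qed.

(* The restriction map V^* / W^perp -> W^* is injective, and it is onto by
   Hahn-Banach, so that the initial topology along it is the weak-* topology
   of W^* transported to V^* / W^perp. *)
HB.instance Definition _ := Topological.copy annihilator_quot
  (initial_topology (annihilator_quot_restr : _ -> weak_star (sub_space W))).

End annihilator.

Section ideals.
Context {R : realType}.

Definition L_summand (X : normedModType R) (Y : submodClosed X) :=
  closed [set` Y] /\
  exists Y' : submodClosed X,
    [/\ forall x, exists y y', [/\ y \in Y, y' \in Y' & x = y + y'],
        [set` Y] `&` [set` Y'] = [set 0] &
        forall y y', y \in Y -> y' \in Y' -> `|y + y'| = `|y| + `|y'|].

Definition M_ideal (V : normedModType R) (W : submodClosed V) :=
  closed [set` W] /\ L_summand (annihilator W).

End ideals.

(* Main.v *)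
(* The dual of [V] carries two facts: every [g] is a difference of positive
   functionals whose norms add up to [`|g|], and the norm is monotone on the dual
   cone; hence [L]-projections are positive. If the norm is monotone on the dual
   cone of [W] as well, which both (i) and (iv) ensure, decomposing a
   norm-preserving extension of a positive functional yields a positive extension.
   Separation shows that (iii) says the same as (ii). Conversely, let (ii) hold. The
   complement of [W^perp] identifies the dual of [W] with a space [Y] of positivity
   and norm preserving extensions, so that order intervals in the dual of [W] can be
   transferred to the dual of [V], and
     [f a - f b <= s * max `|a| `|b|] for all [a], [b] in [W^+]
   implies [`|f| <= s]. This gives (iv), and, by duality, approximate decompositions
   of the elements of [W], made exact by completeness, hence (i). *)
From HB Require Import structures.
Require Import Defs.
From mathcomp Require Import all_boot all_order all_algebra.
From mathcomp Require Import all_classical all_reals all_analysis.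
From mathcomp Require Import ring lra.
Import Order.TTheory GRing.Theory Num.Theory.
Import numFieldNormedType.Exports.
Local Open Scope classical_set_scope.
Local Open Scope ring_scope.

Set Implicit Arguments.
Unset Strict Implicit.
Unset Printing Implicit Defensive.

(** * Sublinear functionals and the Mazur-Orlicz theorem *)

Section sublinear.
Context {R : realType} {E : lmodType R}.
Implicit Types (p q : E -> R) (x y : E) (G : set (E * R)).

(** With [t = 1] the inequality is subadditivity, with [y = 0] it is [p (t *: x) <= t * p x]; for
    [t > 0] the converse follows by using [t^-1]. *)
Definition sublinear p :=
  p 0 = 0 /\ forall t x y, 0 <= t -> p (t *: x + y) <= t * p x + p y.

Lemma sublinearD p x y : sublinear p -> p (x + y) <= p x + p y.
Proof. by case=> _ /(_ 1 x y ler01); rewrite scale1r mul1r. Qed.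

Lemma sublinearN p x : sublinear p -> - p (- x) <= p x.
Proof.
by move=> sp; have := sublinearD x (- x) sp; rewrite subrr sp.1 -lerBlDr sub0r.
Qed.

(** Common to the infimal convolution with a cone and to the infimum of a chain. The infimum is
    finite because an element of [S (- x)] plus one of [S x] dominates an element of [S 0], which is
    nonnegative. *)
Lemma sublinear_inf (S : E -> set R) :
    (forall x, S x !=set0) -> S 0 0 -> lbound (S 0) 0 ->
    (forall t x y r s, 0 <= t -> S x r -> S y s ->
      exists2 u, S (t *: x + y) u & u <= t * r + s) ->
  sublinear (fun x => inf (S x)) /\ forall x r, S x r -> inf (S x) <= r.
Proof.
move=> S0 S00 S0_ge0 SD.
have inf_le x r : S x r -> inf (S x) <= r.
  apply: ge_inf; have [s Ss] := S0 (- x); exists (- s) => u Su.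
  have [v] := SD 1 _ _ _ _ ler01 Su Ss.
  by rewrite scale1r subrr mul1r => /S0_ge0 v0 vus; lra.
split=> //; split.
  by apply/eqP; rewrite eq_le inf_le// lb_le_inf//; exists 0.
move=> t x y t0; rewrite -lerBlDl; apply: lb_le_inf => // s Ss.
have [->|tn0] := eqVneq t 0.
  by rewrite scale0r add0r mul0r subr0 inf_le.
have {}t0 : 0 < t by rewrite lt0r tn0.
rewrite lerBlDr -lerBlDl -ler_pdivrMl//; apply: lb_le_inf => // r Sr.
rewrite ler_pdivrMl// lerBlDr.
have [u /inf_le Su us] := SD _ _ _ _ _ (ltW t0) Sr Ss.
exact: le_trans us.
Qed.

(* The infimal convolution of [p] with the cone [G]; by minimality, a minimal
   sublinear functional is unchanged by it. *)
Lemma sublinear_cone p G : sublinear p -> G (0, 0) ->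
    (forall t x y r s, 0 <= t -> G (x, r) -> G (y, s) ->
      G (t *: x + y, t * r + s)) ->
    (forall x r, G (x, r) -> r <= p x) ->
  exists q, [/\ sublinear q, forall x, q x <= p x &
    forall x r, G (x, r) -> q (- x) <= - r].
Proof.
move=> sp G0 GD Gp; pose S x := [set p (x + y.1) - y.2 | y in G].
have [] := @sublinear_inf S.
- by move=> x; exists (p (x + 0) - 0), (0, 0).
- by exists (0, 0) => //=; rewrite add0r sp.1 subrr.
- by move=> _ [[y r] /= /Gp yr <-]; rewrite add0r subr_ge0.
- move=> t x y _ _ t0 [[u r] /= ur <-] [[v s] /= vs <-].
  exists (p (t *: x + y + (t *: u + v)) - (t * r + s)).
    by exists (t *: u + v, t * r + s) => //; exact: GD.
  rewrite addrACA -scalerDr; have := sp.2 t (x + u) (y + v) t0; lra.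
move=> sq q_le; exists (fun x => inf (S x)); split=> // [x|x r xr].
  by apply: q_le; exists (0, 0) => //=; rewrite addr0 subr0.
by apply: q_le; exists (x, r) => //=; rewrite addNr sp.1 sub0r.
Qed.

(** Zorn's lemma for the reversed pointwise order. A nonempty chain is bounded by its pointwise
    infimum, which is sublinear because the smaller of two members serves at both points. *)
Lemma sublinear_minimal p : sublinear p -> exists q,
  [/\ sublinear q, forall x, q x <= p x &
    forall q', sublinear q' -> (forall x, q' x <= q x) -> q' = q].
Proof.
move=> sp; pose T := {q | sublinear q /\ forall x, q x <= p x}.
pose le_T (q r : T) := `[< forall x, sval r x <= sval q x >].
have [||||[q [sq qp]] q_min] := @Zorn T le_T.
- by move=> q; apply/asboolP.
- by move=> q r s /asboolP qr /asboolP rs; apply/asboolP => x; exact: le_trans (qr x).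
- move=> [q qP] [r rP] /asboolP/= qr /asboolP/= rq; apply: eq_exist => /=.
  by apply/funext => x; apply/eqP; rewrite eq_le qr rq.
- move=> A A_total; have [->|/set0P[q0 Aq0]] := eqVneq A set0.
    by exists (exist _ p (conj sp (fun x => lexx (p x)))).
  pose S x := [set sval q x | q in A].
  have [] := @sublinear_inf S.
  + by move=> x; exists (sval q0 x), q0.
  + by exists q0 => //; exact: (svalP q0).1.1.
  + by move=> _ [q Aq <-]; rewrite (svalP q).1.1.
  + move=> t x y _ _ t0 [q Aq <-] [r Ar <-].
    have [s [As sx sy]] : exists s, [/\ A s, sval s x <= sval q x & sval s y <= sval r y].
      by have [/asboolP qr|/asboolP rq] := A_total _ _ Aq Ar; [exists r|exists q].
    exists (sval s (t *: x + y)); first by exists s.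
    apply: le_trans ((svalP s).1.2 _ _ _ t0) _.
    by rewrite lerD// ler_wpM2l.
  move=> si S_le.
  have ip x : inf (S x) <= p x.
    by apply: le_trans (S_le x _ _) ((svalP q0).2 x); exists q0.
  exists (exist _ (fun x => inf (S x)) (conj si ip)) => q Aq; apply/asboolP => x /=.
  by apply: S_le; exists q.
exists q; split=> // r sr rq.
have rp x : r x <= p x by exact: le_trans (rq x) (qp x).
have := q_min (exist _ r (conj sr rp)).
by move=> H; apply: (congr1 sval (H _)); apply/asboolP.
Qed.

(** Convolving [p] with the ray of [(x, p x)] leaves it unchanged, whence [p (- x) <= - p x]. So [p]
    is odd, and an odd subadditive functional is additive. *)
Lemma sublinear_minimal_linear p : sublinear p ->
    (forall q, sublinear q -> (forall x, q x <= p x) -> q = p) ->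
  linear (p : E -> R^o).
Proof.
move=> sp p_min.
have pZ t x : 0 <= t -> p (t *: x) = t * p x.
  rewrite le0r => /predU1P[->|t0]; first by rewrite scale0r mul0r sp.1.
  apply/eqP; rewrite eq_le; apply/andP; split.
    by have := sp.2 t x 0 (ltW t0); rewrite addr0 sp.1 addr0.
  have := sp.2 t^-1 (t *: x) 0; rewrite invr_ge0 ltW// => /(_ isT).
  by rewrite addr0 sp.1 addr0 scalerA mulVf ?gt_eqF// scale1r ler_pdivlMl.
have pN x : p (- x) = - p x.
  apply/eqP; rewrite eq_le lerNl sublinearN//andbT.
  pose G := [set (t *: x, t * p x) | t in [set t : R | 0 <= t]].
  have [||||q [sq qp qG]] := @sublinear_cone p G.
  - exact: sp.
  - by exists 0 => //=; rewrite scale0r mul0r.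
  - move=> t _ _ _ _ t0 [u u0 [<- <-]] [v v0 [<- <-]]; exists (t * u + v).
      by rewrite /= addr_ge0// mulr_ge0.
    by rewrite scalerDl scalerA mulrDl mulrA.
  - by move=> _ _ [t t0 [<- <-]]; rewrite pZ.
  have := qG x (p x); rewrite (p_min q)//; apply.
  by exists 1; rewrite /= ?ler01// scale1r mul1r.
have pD x y : p (x + y) = p x + p y.
  apply/eqP; rewrite eq_le sublinearD//=.
  have := sublinearD (- x) (- y) sp; rewrite -opprD !pN; lra.
move=> t x y /=; rewrite pD; congr (_ + _).
have [t0|/ltW t0] := leP 0 t; first exact: pZ.
by have := pZ (- t) x; rewrite scaleNr pN oppr_ge0 mulNr => /(_ t0)/oppr_inj.
Qed.

(** Hahn-Banach for a convex cone [G] of constraints [r <= h x]; the extensions, decompositions and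
    separations below come from suitable choices of [G]. *)
Theorem mazur_orlicz p G : sublinear p -> G (0, 0) ->
    (forall t x y r s, 0 <= t -> G (x, r) -> G (y, s) ->
      G (t *: x + y, t * r + s)) ->
    (forall x r, G (x, r) -> r <= p x) ->
  exists h : E -> R^o, [/\ linear h, forall x, h x <= p x &
    forall x r, G (x, r) -> r <= h x].
Proof.
move=> sp G0 GD Gp; have [q [sq qp qG]] := sublinear_cone sp G0 GD Gp.
have [h [sh hq h_min]] := sublinear_minimal sq.
exists h; split=> [|x|x r xr]; first exact: sublinear_minimal_linear.
  exact: le_trans (qp x).
(* This is the chain [r <= - q (- x) <= - h (- x) <= h x]. *)
have := sublinearN x sh; have := hq (- x); have := qG _ _ xr; lra.
Qed.

End sublinear.

(** * Bounded functionals from constraints, products and extensions *)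

Section dual_extension.
Context {R : realType} {E : normedModType R}.
Implicit Types (x y : E) (f g : dual_space E).

Lemma dual_spaceP f g : (forall x, f x = g x) -> f = g.
Proof. by move=> fg; apply/val_inj/funext. Qed.

Lemma ler_dual f x : f x <= `|f| * `|x|.
Proof. by apply: le_trans (ler_norm _) _; exact: ler_dual_norm. Qed.

Lemma dual_le f (c : R) : 0 <= c -> (forall x, f x <= c * `|x|) -> `|f| <= c.
Proof.
move=> c0 fc; apply: dual_norm_le => x x1; rewrite ler_norml lerNl -linearN.
have cle y : `|y| <= 1 -> f y <= c.
  by move=> y1; apply: le_trans (fc y) _; rewrite ler_piMr.
by rewrite !cle ?normrN.
Qed.

Lemma dual_of_linear (h : E -> R^o) (c : R) : 0 <= c -> linear h ->
    (forall x, h x <= c * `|x|) ->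
  exists2 f : dual_space E, `|f| <= c & forall x, f x = h x.
Proof.
move=> c0 lh hc.
pose hL : {linear E -> R^o} := HB.pack h (GRing.isLinear.Build _ _ _ _ h lh).
have hN x : h (- x) = - h x by exact: (linearN hL).
have hE : h \in dual_pred E.
  apply/asboolP; split=> //; apply: (@bounded_linear_continuous _ _ _ hL).
  apply/linear_boundedP; near=> r => x /=.
  have cr : c * `|x| <= r * `|x| by rewrite ler_wpM2r.
  rewrite ler_norml lerNl; apply/andP; split; apply: le_trans cr => //.
  by rewrite -hN -[`|x|]normrN.
by exists (exist _ h hE) => //; exact: dual_le.
Unshelve. all: by end_near. Qed.

Theorem mazur_orlicz_dual (c : R) (G : set (E * R)) : 0 <= c -> G (0, 0) ->
    (forall t x y r s, 0 <= t -> G (x, r) -> G (y, s) ->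
      G (t *: x + y, t * r + s)) ->
    (forall x r, G (x, r) -> r <= c * `|x|) ->
  exists2 f : dual_space E, `|f| <= c & forall x r, G (x, r) -> r <= f x.
Proof.
move=> c0 G0 GD Gc.
have sc : sublinear (fun x => c * `|x|).
  split=> [|t x y t0]; first by rewrite normr0 mulr0.
  rewrite mulrCA -mulrDr ler_wpM2l//; apply: le_trans (ler_normD _ _) _.
  by rewrite normrZ ger0_norm.
have [h [lh hc hG]] := mazur_orlicz sc G0 GD Gc.
have [f fc fh] := dual_of_linear c0 lh hc.
by exists f => // x r xr; rewrite fh hG.
Qed.

End dual_extension.

(** The product carries the max norm, so its dual norm is the sum of the norms of the components;
    this is why the norms of decompositions add up. *)
Lemma dual_prod {R : realType} {E : normedModType R} (F : dual_space (E * E)%type) :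
  exists h k : dual_space E,
  (forall x y, F (x, y) = h x + k y) /\ `|h| + `|k| <= `|F|.
Proof.
have FE x y : F (x, y) = F (x, 0) + F (0, y).
  rewrite -linearD/=; congr (F _).
  by apply/pair_equal_spec; split; rewrite /= ?addr0 ?add0r.
have l1 : linear (fun x => F (x, 0)).
  move=> a x y; rewrite -linearP; congr (F _).
  by apply/pair_equal_spec; split; rewrite //= scaler0 addr0.
have l2 : linear (fun y => F (0, y)).
  move=> a x y; rewrite -linearP; congr (F _).
  by apply/pair_equal_spec; split; rewrite //= scaler0 addr0.
have [||h _ hF] := @dual_of_linear _ _ _ `|F| _ l1; first exact: normr_ge0.
  move=> x; apply: (le_trans (ler_dual _ _)); rewrite ler_wpM2l//.
  by rewrite prod_normE/= normr0 ge_max lexx normr_ge0.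
have [||k _ kF] := @dual_of_linear _ _ _ `|F| _ l2; first exact: normr_ge0.
  move=> x; apply: (le_trans (ler_dual _ _)); rewrite ler_wpM2l//.
  by rewrite prod_normE/= normr0 ge_max lexx normr_ge0.
exists h, k; split=> [x y|]; first by rewrite FE hF kF.
have FD x y : `|x| <= 1 -> `|y| <= 1 -> h x + k y <= `|F|.
  move=> x1 y1; rewrite hF kF -FE; apply: le_trans (ler_dual _ _) _.
  by rewrite ler_piMr// prod_normE/= ge_max x1.
(* Changing the signs of [x] and [y] separately makes both values nonnegative. *)
have FD' x y : `|x| <= 1 -> `|y| <= 1 -> `|h x| + `|k y| <= `|F|.
  move=> x1 y1; have nx1 : `|- x| <= 1 by rewrite normrN.
  have ny1 : `|- y| <= 1 by rewrite normrN.
  have hN : h (- x) = - h x by rewrite linearN.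
  have kN : k (- y) = - k y by rewrite linearN.
  by case: ger0P => _; case: ger0P => _; rewrite -?hN -?kN; exact: FD.
rewrite -lerBrDr; apply: dual_norm_le => x x1.
rewrite lerBrDr addrC -lerBrDr; apply: dual_norm_le => y y1.
by rewrite lerBrDr addrC FD'.
Qed.

Lemma hahn_banach_extension {R : realType} {V : normedModType R}
    (W : submodClosed V) (f : dual_space (sub_space W)) :
  exists2 g : dual_space V, `|g| <= `|f| & dual_restr W g = f.
Proof.
(* The graph of [f] is a linear subspace, so the constraints at [w] and [- w] together force
   equality. *)
pose G := [set (val w, f w : R) | w in [set: sub_space W]].
have [||||g gf gG] := @mazur_orlicz_dual R V `|f| G.
- exact: normr_ge0.
- by exists 0 => //; rewrite !linear0.
- move=> t _ _ _ _ t0 [u _ [<- <-]] [v _ [<- <-]]; exists (t *: u + v) => //.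
  by rewrite !linearP.
- by move=> _ _ [w _ [<- <-]]; rewrite -sub_space_normE ler_dual.
exists g => //; apply: dual_spaceP => w.
have fg u : f u <= g (val u) by apply: gG; exists u.
by apply/eqP; rewrite eq_le fg andbT; have := fg (- w); rewrite !linearN lerN2.
Qed.

Lemma dual_restr_norm {R : realType} {V : normedModType R} (W : submodClosed V)
    (g : dual_space V) : `|dual_restr W g| <= `|g|.
Proof. by apply: dual_le => // w; rewrite sub_space_normE; exact: (ler_dual g). Qed.

(** * Decomposition, monotonicity and separation in the ordered dual *)

Section order_dual.
Context {R : realType} {V : normedModType R} (C : set V).

Lemma proper_cone0 : proper_cone C -> C 0.
Proof. by rewrite /proper_cone => C0; have [] : (C `&` -%R @` C) 0 by rewrite C0. Qed.

(** For [u], [v] in [C], [x - v <= x <= x + u], so [order_smooth_oo1] bounds [g x] by [|g|] times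
    the max norm of [(x + u, v - x)]. A functional on the product that is at least [g x] at these
    points has components [g1] and [g2]. *)
Lemma dual_decomposition (g : dual_space V) :
    cone C -> C 0 -> order_smooth_oo1 C ->
  exists g1 g2, [/\ dual_cone C g1, dual_cone C g2, g = g1 - g2 &
    `|g1| + `|g2| <= `|g|].
Proof.
move=> coneC C0 C1.
pose G : set (V * V * R) := [set z | exists x u v,
  [/\ C u, C v & z = ((x + u, v - x), g x : R)]].
have [||||F Fg FG] := @mazur_orlicz_dual R (V * V)%type `|g| G.
- exact: normr_ge0.
- by exists 0, 0, 0; split=> //; rewrite addr0 subr0 linear0.
- move=> t _ _ _ _ t0 [x [u [v [Cu Cv [-> ->]]]]] [x' [u' [v' [Cu' Cv' [-> ->]]]]].
  exists (t *: x + x'), (t *: u + u'), (t *: v + v'); split; [exact: coneC..|].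
  congr (_, _); last by rewrite linearP.
  apply: injective_projections => /=.
    by rewrite scalerDr addrACA.
  by rewrite scalerBr addrACA opprD.
- move=> _ _ [x [u [v [Cu Cv [-> ->]]]]].
  apply: le_trans (ler_dual _ _) _; rewrite ler_wpM2l// prod_normE/=.
  rewrite [X in Num.max _ X]distrC maxC.
  by apply: C1; rewrite /cone_le ?opprB ?[x + u]addrC ?addrK// addrC subrK.
have [h [k [Fhk hk]]] := dual_prod F.
have FE x u v : C u -> C v -> g x <= h (x + u) + k (v - x).
  by move=> Cu Cv; rewrite -Fhk; apply: FG; exists x, u, v.
exists h, k; split.
- by move=> u Cu; have := FE 0 u 0 Cu C0; rewrite add0r subr0 !linear0 addr0.
- by move=> v Cv; have := FE 0 0 v C0 Cv; rewrite add0r subr0 !linear0 add0r.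
- have le_g x : g x <= h x - k x.
    by have := FE x 0 0 C0 C0; rewrite addr0 sub0r linearN.
  apply: dual_spaceP => x; apply/eqP; rewrite eq_le le_g/=.
  by have := le_g (- x); rewrite !linearN opprK addrC -opprB lerN2.
- exact: le_trans hk Fg.
Qed.

(** Write [x = v1 - v2] with [v1], [v2] in [C] of norm barely above [|x|]; then [f v1 <= h v1] and
    [- f v2 <= k v2]. *)
Lemma dual_interval_norm (f h k : dual_space V) : order_smooth_oo2 C ->
    (forall v, C v -> f v <= h v) -> (forall v, C v -> - k v <= f v) ->
  `|f| <= `|h| + `|k|.
Proof.
move=> C2 fh kf; set c := `|h| + `|k|.
have c0 : 0 <= c by rewrite addr_ge0.
apply: dual_le => // x; apply/ler_addgt0Pr => e e0.
have c1 : 0 < c + 1 by rewrite ltr_wpDl.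
(* Chosen so that [c * d <= e], also when [c = 0]. *)
pose d := e / (c + 1); have d0 : 0 < d by rewrite divr_gt0.
have [v1 [v2 [Cv1 Cv2 xE vx]]] := C2 x d d0.
have [v1x v2x] : `|v1| <= `|x| + d /\ `|v2| <= `|x| + d.
  by move: vx; rewrite gt_max => /andP[/ltW v1x /ltW v2x]; split.
rewrite {1}xE linearB/=; apply: (@le_trans _ _ (c * (`|x| + d))).
  rewrite mulrDl; apply: lerD.
    by apply: le_trans (fh _ Cv1) (le_trans (ler_dual _ _) _); rewrite ler_wpM2l.
  rewrite lerNl; apply: le_trans (kf _ Cv2); rewrite lerN2.
  by apply: le_trans (ler_dual _ _) _; rewrite ler_wpM2l.
rewrite mulrDr lerD2l /d mulrCA ler_piMr ?(ltW e0)//.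
by rewrite ler_pdivrMr// mul1r lerDl.
Qed.

Lemma dual_cone_norm_le (f g : dual_space V) : order_smooth_oo2 C ->
  dual_cone C f -> (forall v, C v -> f v <= g v) -> `|f| <= `|g|.
Proof.
move=> C2 f0 fg; have := @dual_interval_norm f g 0 C2 fg.
rewrite normr0 addr0; apply=> v Cv.
by rewrite -[X in - X]/(0 : R) oppr0; exact: f0.
Qed.

(* If [a1 - a2] and [b1 - b2] are norm-additive decompositions of [a] and [b],
   then [0 <= a + b <= a1 + b1] while
   [`|a + b| = `|a1| + `|a2| + `|b1| + `|b2|], so that [a2] and [b2] vanish. *)
Lemma dual_cone_L_summand (a b : dual_space V) : order_smooth_oo_normed C ->
  `|a + b| = `|a| + `|b| -> dual_cone C (a + b) -> dual_cone C b.
Proof.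
move=> [coneC /proper_cone0 C0 _ _ C1 C2] ab ab0.
have [a1 [a2 [a1p a2p aE an]]] := dual_decomposition a coneC C0 C1.
have [b1 [b2 [b1p b2p bE bn]]] := dual_decomposition b coneC C0 C1.
have le1 : `|a + b| <= `|a1 + b1|.
  apply: dual_cone_norm_le => // v Cv; rewrite aE bE.
  rewrite -[leLHS]/(a1 v - a2 v + (b1 v - b2 v)) -[leRHS]/(a1 v + b1 v).
  by apply: lerD; rewrite gerBl; [exact: a2p|exact: b2p].
have b2_0 : b2 = 0.
  apply/eqP; rewrite -normr_le0; have := normr_ge0 a2; have := ler_normD a1 b1.
  lra.
by rewrite bE b2_0 subr0.
Qed.

(** Otherwise [x] is at distance at least some [e > 0] from [C], which leaves room for a positive
    functional with [f x <= - e]. *)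
Lemma dual_cone_separation (x : V) : closed C -> cone C -> C 0 ->
  (forall f, dual_cone C f -> 0 <= f x) -> C x.
Proof.
move=> clC coneC C0 fx; apply: contrapT => Cx.
have [e e0 xe] : exists2 e : R, 0 < e & forall k, C k -> e <= `|x - k|.
  have : nbhs x (~` C) by apply: open_nbhs_nbhs; split=> //; rewrite openC.
  rewrite -nbhs_ballE => -[e e0]; rewrite -ball_normE => xC; exists e => // k Ck.
  by rewrite leNgt; apply/negP => xk; exact: (xC k xk Ck).
(* The constraints with [t = 0] make [f] nonnegative on [C]; the one with [k = 0], [t = 1] gives
   [f x <= - e]. *)
pose G : set (V * R) := [set z | exists k t,
  [/\ C k, 0 <= t & z = (k - t *: x, t * e)]].
have [||||f _ fG] := @mazur_orlicz_dual R V 1 G.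
- exact: ler01.
- by exists 0, 0; split=> //; rewrite scale0r subr0 mul0r.
- move=> s _ _ _ _ s0 [k [t [Ck t0 [-> ->]]]] [k' [t' [Ck' t'0 [-> ->]]]].
  exists (s *: k + k'), (s * t + t'); split; first exact: coneC.
    by rewrite addr_ge0// mulr_ge0.
  congr (_, _); last by rewrite mulrDl mulrA.
  by rewrite scalerBr addrACA -opprD scalerDl scalerA.
- move=> _ _ [k [t [Ck t0 [-> ->]]]]; rewrite mul1r.
  have [->|tn0] := eqVneq t 0; first by rewrite mul0r.
  have -> : k - t *: x = - (t *: (x - t^-1 *: k)).
    by rewrite scalerBr scalerA divff// scale1r opprB.
  rewrite normrN normrZ ger0_norm// ler_wpM2l// xe//.
  by rewrite -[_ *: k]addr0; apply: coneC; rewrite ?invr_ge0.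
have [] : f x <= - e /\ 0 <= f x; last by lra.
split.
  have /fG : G (0 - 1 *: x, 1 * e) by exists 0, 1; split.
  by rewrite sub0r scale1r linearN mul1r lerNr.
apply: fx => k Ck; have /fG : G (k - 0 *: x, 0 * e) by exists k, 0; split.
by rewrite scale0r subr0 mul0r.
Qed.

End order_dual.

(* [submodClosed] is about semimodules, for which [rpredB] is not available. *)
Lemma submodClosedB {R : pzRingType} {V : lmodType R} (Y : submodClosed V) :
  {in Y &, forall u v, u - v \in Y}.
Proof. by move=> u v uY vY; rewrite -scaleN1r rpredD// rpredZ. Qed.

(** * Positive functionals on a subspace and their extensions *)

Section subspace_dual.
Context {R : realType} {V : normedModType R} (Vp : set V) (W : submodClosed V).
Hypothesis oV : order_smooth_oo_normed Vp.
Let Wp : set (sub_space W) := sub_cone Vp.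

Let coneV : cone Vp. Proof. exact: order_smooth_cone oV. Qed.
Let V0 : Vp 0. Proof. exact: proper_cone0 (order_smooth_proper oV). Qed.

Lemma dual_restr_cone (g : dual_space V) :
  dual_cone Vp g -> dual_cone Wp (dual_restr W g).
Proof. by move=> g0 w Ww; exact: (g0 (val w)). Qed.

(* Decompose a norm-preserving extension of [f] as [g1 - g2]: as [f <= g1] on
   the cone of [W], [`|f| <= `|g1| <= `|f| - `|g2|]. *)
Lemma dual_cone_extension :
    (forall f h : dual_space (sub_space W), dual_cone Wp f ->
      (forall w, Wp w -> f w <= h w) -> `|f| <= `|h|) ->
  forall f, dual_cone Wp f -> exists2 g, dual_cone Vp g & dual_restr W g = f.
Proof.
move=> mono f f0; have [g gf gE] := hahn_banach_extension f.
have [g1 [g2 [g1p g2p gD gn]]] :=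
    dual_decomposition g coneV V0 (order_smooth_le_max oV).
have fg1 : `|f| <= `|dual_restr W g1|.
  apply: mono => // w Ww; rewrite -gE gD.
  by rewrite -[leLHS]/(g1 (val w) - g2 (val w)) gerBl; exact: g2p.
have g2_0 : g2 = 0.
  apply/eqP; rewrite -normr_le0; have := dual_restr_norm W g1; lra.
by exists g1 => //; rewrite -gE gD g2_0 subr0.
Qed.

Lemma annihilator_restrP (f g : dual_space V) :
  (f - g \in annihilator W) = (dual_restr W f == dual_restr W g).
Proof.
by rewrite -annihilator_pi_eq /annihilator_pi -Quotient.idealrBE.
Qed.

(** [Y] is the complement of the annihilator. Restriction is injective on it because the two meet in
    [0]. The component of [g] in [Y] has the same restriction as [g], and additivity of the norm
    makes it positive when [g] is. *)
Lemma L_summand_annihilatorP : L_summand (annihilator W) ->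
  exists Y : submodClosed (dual_space V),
    (forall f g : dual_space V, f \in Y -> g \in Y ->
      dual_restr W f = dual_restr W g -> f = g) /\
    forall g : dual_space V, exists g' : dual_space V,
      [/\ g' \in Y, dual_restr W g' = dual_restr W g,
      `|g'| <= `|g| & dual_cone Vp g -> dual_cone Vp g'].
Proof.
move=> [_ [Y [Ysum Ycap Ynorm]]]; exists Y; split=> [f g fY gY fg|g].
  apply/eqP; rewrite -subr_eq0; apply/eqP.
  have : ([set` annihilator W] `&` [set` Y]) (f - g).
    split; last by change (f - g \in Y); exact: submodClosedB.
    by change (f - g \in annihilator W); rewrite annihilator_restrP fg.
  by rewrite Ycap.
have [a [b [aW bY gE]]] := Ysum g; exists b; split=> //.
- by apply/eqP; rewrite eq_sym -annihilator_restrP gE addrK.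
- by rewrite gE Ynorm// lerDr.
- by rewrite gE; apply: dual_cone_L_summand => //; exact: Ynorm.
Qed.

(* Dominate [f] and [- f] on the cone of [W] by positive functionals of total norm
   at most [s], and transfer the resulting order interval around [f] to [V]. *)
Lemma dual_norm_le_cone (f : dual_space (sub_space W)) (s : R) :
    L_summand (annihilator W) ->
    (forall f, dual_cone Wp f -> exists2 g, dual_cone Vp g & dual_restr W g = f) ->
    0 <= s ->
    (forall a b, Wp a -> Wp b -> f a - f b <= s * Num.max `|a| `|b|) ->
  `|f| <= s.
Proof.
move=> /L_summand_annihilatorP[Y [Y_inj Y_lift]] ext s0 fs.
pose G : set (sub_space W * sub_space W * R) := [set z | exists a b,
  [/\ Wp a, Wp b & z = ((a, b), f a - f b : R)]].
have Wp0 : Wp 0 by [].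
have WpD t a b : 0 <= t -> Wp a -> Wp b -> Wp (t *: a + b).
  by move=> t0 Wa Wb; exact: coneV.
have [||||F Fs FG] := @mazur_orlicz_dual R (sub_space W * sub_space W)%type s G.
- by [].
- by exists 0, 0; split=> //; rewrite !linear0 addr0.
- move=> t _ _ _ _ t0 [a [b [Wa Wb [-> ->]]]] [a' [b' [Wa' Wb' [-> ->]]]].
  exists (t *: a + a'), (t *: b + b'); split; [exact: WpD..|].
  congr (_, _); rewrite !(dual_fun_linear f) opprD addrACA; congr (_ + _).
  exact: mulrBr.
- by move=> _ _ [a [b [Wa Wb [-> ->]]]]; rewrite prod_normE; exact: fs.
have [h [k [Fhk hk]]] := dual_prod F.
have FE a b : Wp a -> Wp b -> f a - f b <= h a + k b.
  by move=> Wa Wb; rewrite -Fhk; apply: FG; exists a, b.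
have fh a : Wp a -> f a <= h a.
  by move=> Wa; have := FE a 0 Wa Wp0; rewrite !linear0 !addr0.
have kf b : Wp b -> - f b <= k b.
  by move=> Wb; have := FE 0 b Wp0 Wb; rewrite !linear0 !add0r.
(* Keep the positive part [g1] of a norm-preserving extension of [l] and pass to its component in
   [Y]; subtracting [g2] only lowers values on the cone. *)
have dominate (l : dual_space (sub_space W)) : exists L : dual_space V,
    [/\ L \in Y, `|L| <= `|l| & forall w, Wp w -> l w <= L (val w)].
  have [g gl gE] := hahn_banach_extension l.
  have [g1 [g2 [g1p g2p gD gn]]] :=
    dual_decomposition g coneV V0 (order_smooth_le_max oV).
  have [L [LY LE Ln _]] := Y_lift g1; exists L; split=> //.
    by have := normr_ge0 g2; lra.
  move=> w Ww; rewrite -[L _]/(dual_restr W L w) LE -gE gD.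
  by rewrite -[leLHS]/(g1 (val w) - g2 (val w)) gerBl; exact: g2p.
have [H [HY Hh hH]] := dominate h; have [K [KY Kk kK]] := dominate k.
have [g gf gE] := hahn_banach_extension f.
have [A [AY AE _ _]] := Y_lift g; rewrite gE in AE.
(* A positive extension of the restriction of [L] has a positive component in [Y], and this
   component is [L] by injectivity. *)
have pos (L : dual_space V) : L \in Y -> dual_cone Wp (dual_restr W L) -> dual_cone Vp L.
  move=> LY /ext[L' L'0 L'E]; have [L1 [L1Y L1E _ /(_ L'0) L10]] := Y_lift L'.
  by rewrite -(Y_inj L1 L)// L1E.
have HA : dual_cone Vp (H - A).
  apply: pos => [|w Ww]; first exact: submodClosedB.
  rewrite -[X in 0 <= X]/(H (val w) - dual_restr W A w) AE subr_ge0.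
  exact: le_trans (fh _ Ww) (hH _ Ww).
have KA : dual_cone Vp (K + A).
  apply: pos => [|w Ww]; first exact: rpredD.
  rewrite -[X in 0 <= X]/(K (val w) + dual_restr W A w) AE -lerBlDr sub0r.
  exact: le_trans (kf _ Ww) (kK _ Ww).
(* On [Vp] now [- K <= A <= H], while [|H| + |K| <= |h| + |k| <= s]. *)
rewrite -AE; apply: le_trans (dual_restr_norm W A) _.
apply: (@le_trans _ _ (`|H| + `|K|)); last by lra.
apply: dual_interval_norm (order_smooth_decomposition oV) _ _ => v Vv.
  by have := HA _ Vv; rewrite -[X in 0 <= X]/(H v - A v) subr_ge0.
by have := KA _ Vv; rewrite -[X in 0 <= X]/(K v + A v) -lerBlDr sub0r lerNl.
Qed.

End subspace_dual.

(** * The weak-* closure of the image of the dual cone *)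

Lemma cvg_initial_topology {S : choiceType} {T : topologicalType} (f : S -> T)
    (F : set_system S) (s : S) : Filter F ->
  F --> (s : initial_topology f) <-> f @ F --> f s.
Proof.
move=> FF; split=> [Fs|fFs].
  by apply: cvg_comp Fs _; exact: (@initial_continuous _ _ f s).
move=> A /= [_ [[B Bop <-] Bfs sBA]].
have : nbhs (f s) B by rewrite nbhsE; exists B.
by move=> /fFs FB; exact: filterS sBA FB.
Qed.

Section weak_star_quotient.
Context {R : realType} {V : normedModType R} (W : submodClosed V).

(** The quotient and the weak-* dual both carry initial topologies; unfolding the two leaves
    pointwise convergence on [W]. *)
Lemma cvg_annihilator_quotP (F : set_system (annihilator_quot W))
    (q : annihilator_quot W) : Filter F ->
  F --> q <-> forall w : sub_space W,
    (fun p => annihilator_quot_restr p w) @ F --> annihilator_quot_restr q w.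
Proof.
move=> FF; split.
  move=> /cvg_initial_topology /cvg_initial_topology /pointwise_cvgP Fq w.
  exact: Fq.
move=> Fq; apply/cvg_initial_topology/cvg_initial_topology/pointwise_cvgP.
exact: Fq.
Qed.

End weak_star_quotient.

Section weak_star_density.
Context {R : realType} {V : normedModType R} (Vp : set V) (W : submodClosed V).
Hypotheses (coneV : cone Vp) (V0 : Vp 0) (clV : closed Vp).

(* Otherwise, a linear form on [R^n] strictly separates [(f (w j))_j] from the
   cone of all the [(h (w j))_j]; it is the evaluation at some [u] in [W], which
   belongs to the closed cone [Vp] although [f u < 0]. *)
Lemma dual_cone_approximation (f : dual_space (sub_space W)) (n : nat)
    (w : 'I_n -> sub_space W) (e : R) : dual_cone (sub_cone Vp) f -> 0 < e ->
  exists2 h, dual_cone Vp h & forall j, `|h (val (w j)) - f (w j)| < e.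
Proof.
move=> f0 e0; apply: contrapT => /forall2NP far.
have {}far (h : dual_space V) : dual_cone Vp h ->
    e <= `|\row_j (h (val (w j)) - f (w j))|.
  move=> h0; rewrite leNgt; apply/negP => lt_e.
  have [//|[]] := far h; move=> j; apply: le_lt_trans lt_e.
  rewrite [leRHS](_ : _ = mx_norm (\row_j (h (val (w j)) - f (w j))))//.
  rewrite mx_normrE; apply: le_trans (le_bigmax _ _ (ord0, j)).
  by rewrite /= mxE.
pose G : set ('rV[R]_n * R) := [set z | exists (h : dual_space V) t,
  [/\ dual_cone Vp h, 0 <= t &
    z = (\row_j (h (val (w j)) - t * f (w j)), t * e)]].
have zero0 : dual_cone Vp 0 by move=> v _; exact: lexx.
have [||||L _ LG] := @mazur_orlicz_dual R 'rV[R]_n 1 G.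
- exact: ler01.
- exists 0, 0; split=> //; congr (_, _); last by rewrite mul0r.
  by apply/rowP => j; rewrite !mxE mul0r subr0.
- move=> s _ _ _ _ s0 [h [t [h0 t0 [-> ->]]]] [h' [t' [h'0 t'0 [-> ->]]]].
  exists (s *: h + h'), (s * t + t'); split.
  + move=> v Vv; rewrite -[X in _ <= X]/(s * h v + h' v) addr_ge0//; last exact: h'0.
    by rewrite mulr_ge0//; exact: h0.
  + by rewrite addr_ge0// mulr_ge0.
  + congr (_, _); last by rewrite mulrDl mulrA.
    apply/rowP => j; rewrite !mxE.
    rewrite -[(s *: h + h' : dual_space V) _]/(s * h (val (w j)) + h' (val (w j))); ring.
- move=> _ _ [h [t [h0 t0 [-> ->]]]]; rewrite mul1r.
  have [->|tn0] := eqVneq t 0; first by rewrite mul0r.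
  have -> : \row_j (h (val (w j)) - t * f (w j)) =
      t *: \row_j ((t^-1 *: h : dual_space V) (val (w j)) - f (w j)).
    apply/rowP => j; rewrite !mxE.
    by rewrite -[(t^-1 *: h : dual_space V) _]/(t^-1 * h (val (w j))) mulrBr mulVKf.
  rewrite normrZ ger0_norm// ler_wpM2l//; apply: far => v Vv.
  rewrite -[X in _ <= X]/(t^-1 * h v) mulr_ge0 ?invr_ge0//; exact: h0.
(* [L] acts on rows of values as evaluation at [u]. The constraints with [t = 0] give [0 <= h u] for
   every positive [h]; the one with [h = 0], [t = 1] gives [f u <= - e]. *)
pose u := \sum_j (L 'e_j : R) *: w j.
have LE (h : dual_space (sub_space W)) : L (\row_j h (w j)) = h u.
  rewrite [X in L X]row_sum_delta !linear_sum/=; apply: eq_bigr => j _.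
  by rewrite !linearZ/= mxE; exact: mulrC.
have : L (\row_j - f (w j)) = - f u by rewrite -[RHS](LE (- f)).
have /LG : G (\row_j (0 - 1 * f (w j)), 1 * e).
  by exists 0, 1; split.
have -> : \row_j (0 - 1 * f (w j)) = \row_j - f (w j).
  by apply/rowP => j; rewrite !mxE sub0r mul1r.
have /f0 : sub_cone Vp u.
  apply: (@dual_cone_separation _ _ Vp (val u)) => // h h0.
  rewrite -[X in 0 <= X]/(dual_restr W h u) -LE.
  have /LG : G (\row_j (h (val (w j)) - 0 * f (w j)), 0 * e) by exists h, 0.
  rewrite mul0r; congr (0 <= L _).
  by apply/rowP => j; rewrite !mxE mul0r subr0.
by move=> fu Le LfE; move: Le; rewrite LfE; lra.
Qed.

Let image := annihilator_pi W @` dual_cone Vp.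

(** Evaluation at a point of the cone of [W] is continuous, so limits of positive classes stay
    positive there. Conversely, [dual_cone_approximation] makes the sets [B] a base of a proper
    filter converging to the class of [f]. *)
Lemma closure_dual_coneP (f : dual_space V) :
  closure image (annihilator_pi W f) <-> dual_cone (sub_cone Vp) (dual_restr W f).
Proof.
split=> [+ w Ww|f0].
  rewrite closureEcvg => -[F PF [/cvg_annihilator_quotP/(_ w) Fw imF]].
  rewrite annihilator_quot_restrE in Fw.
  apply: (@closed_cvg _ R F PF _ [set x : R | 0 <= x] _ _ _ Fw).
    exact: closed_ge.
  apply: imF => _ [g g0 <-]; rewrite annihilator_quot_restrE.
  exact: (dual_restr_cone g0 Ww).
pose B (i : seq (sub_space W) * R) := [set annihilator_pi W g | g in
  [set g | dual_cone Vp g /\ forall w, w \in i.1 -> `|g (val w) - f (val w)| < i.2]].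
have FF : Filter (filter_from [set i | 0 < i.2] B).
  apply: filter_from_filter; first by exists ([::], 1) => /=.
  move=> [s d] [s' d'] /= d0 d'0; exists (s ++ s', Num.min d d').
    by rewrite /= lt_min d0.
  move=> _ [g [g0 gB] <-]; split; exists g => //; split=> // w ws.
    by have := gB w; rewrite mem_cat ws lt_min => /(_ isT)/andP[].
  by have := gB w; rewrite mem_cat ws orbT lt_min => /(_ isT)/andP[].
rewrite closureEcvg; exists (filter_from [set i | 0 < i.2] B).
  apply: filter_from_proper => -[s d] /= d0.
  have [g g0 gd] := dual_cone_approximation (tnth (in_tuple s)) f0 d0.
  exists (annihilator_pi W g), g => //; split=> // w /(tnthP (in_tuple s))[j ->].
  exact: gd.
split.
  apply/cvg_annihilator_quotP => w; rewrite annihilator_quot_restrE.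
  apply/cvgrPdist_lt => e e0; exists ([:: w], e) => // _ [g [_ gB] <-].
  by rewrite /= annihilator_quot_restrE distrC; apply: gB; rewrite inE.
(* Without test points the basic set is the whole image. *)
move=> A imA; exists ([::], 1) => //= _ [g [g0 _] <-]; apply: imA.
by exists g.
Qed.

(** By Hahn-Banach every functional on [W] comes from a class: the positive ones from the closure,
    those with a positive extension from the image itself. *)
Lemma closed_annihilator_pi_dual_coneP :
  image = closure image <->
  forall f : dual_space (sub_space W), dual_cone (sub_cone Vp) f ->
    exists2 g : dual_space V, dual_cone Vp g & dual_restr W g = f.
Proof.
split=> [imE f f0|ext].
  have [f' _ f'E] := hahn_banach_extension f.
  have : image (annihilator_pi W f').
    by rewrite imE; apply/closure_dual_coneP; rewrite f'E.
  move=> [g g0 /eqP]; rewrite annihilator_pi_eq => /eqP gE.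
  by exists g; rewrite // gE.
apply/seteqP; split; first exact: subset_closure.
move=> q; rewrite -[q]reprK => /closure_dual_coneP/ext[g g0 gE].
by exists g => //; apply/eqP; rewrite annihilator_pi_eq gE.
Qed.

End weak_star_density.

(** * Decompositions inside the subspace, by duality and completeness *)

Lemma cvg_series_cone {R : realType} {V : completeNormedModType R} (K : set V)
    (u : nat -> V) (M : R) : closed K -> cone K -> K 0 -> (forall n, K (u n)) ->
    (forall n, \sum_(0 <= k < n) `|u k| <= M) ->
  exists l, [/\ K l, `|l| <= M & series u @ \oo --> l].
Proof.
move=> clK coneK K0 Ku uM.
have cu : cvgn (series u).
  apply: normed_cvg; apply: nondecreasing_is_cvgn.
    by apply/nondecreasing_seqP => n; rewrite /= seriesSr lerDl.
  by exists M => _ [n _ <-]; exact: uM.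
exists (limn (series u)); split=> //.
  apply: (@closed_cvg _ V \oo _ _ K clK _ _ cu); apply: nearW => n.
  elim: n => [|n IHn]; first by rewrite [series u 0%N]big_geq.
  by rewrite seriesSr addrC -[u n]scale1r; exact: coneK.
apply: (@closed_cvg _ R \oo _ _ [set x : R | x <= M] _ _ _ (cvg_norm cu)).
  exact: closed_le.
by apply: nearW => n; apply: le_trans (uM n); exact: ler_norm_sum.
Qed.

Section subspace_order_smooth.
Context {R : realType} {V : completeNormedModType R} (Vp : set V).
Context (W : submodClosed V).
Hypotheses (oV : order_smooth_oo_normed Vp) (clW : closed [set` W]).
Let Wp : set (sub_space W) := sub_cone Vp.

Let Wp0 : Wp 0.
Proof. exact: (proper_cone0 (order_smooth_proper oV)). Qed.

Let WpD t a b : 0 <= t -> Wp a -> Wp b -> Wp (t *: a + b).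
Proof. by move=> t0 Wa Wb; exact: (order_smooth_cone oV). Qed.

Let WpZ t a : 0 <= t -> Wp a -> Wp (t *: a).
Proof. by move=> t0 Wa; rewrite -[t *: a]addr0; exact: WpD. Qed.

(* The gauge [inf_(a, b) max `|a| `|b| + M * `|w - (a - b)|] is at most [`|w|]:
   a functional below it satisfies [f a - f b <= max `|a| `|b|] on the cone. *)
Lemma sub_cone_approximation (w : sub_space W) (d : R) :
    L_summand (annihilator W) ->
    (forall f, dual_cone Wp f -> exists2 g, dual_cone Vp g & dual_restr W g = f) ->
    0 < d ->
  exists a b, [/\ Wp a, Wp b, `|a| <= `|w| + d, `|b| <= `|w| + d &
    `|w - (a - b)| <= d].
Proof.
(* The penalty [M] is such that [M * r <= c] means [r <= d]. *)
move=> LW ext d0; pose c := `|w| + d; pose M := c / d.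
have c0 : 0 < c by rewrite ltr_wpDl.
have M0 : 0 < M by rewrite divr_gt0.
apply: contrapT => no_ab.
have cM a b : Wp a -> Wp b -> c <= Num.max `|a| `|b| + M * `|w - (a - b)|.
  move=> Wa Wb; rewrite leNgt; apply/negP => lt_c; apply: no_ab; exists a, b.
  have max0 : 0 <= Num.max `|a| `|b| by rewrite le_max normr_ge0.
  have M1 : 0 <= M * `|w - (a - b)| by rewrite mulr_ge0// ltW.
  have maxc : Num.max `|a| `|b| <= c by lra.
  move: (maxc); rewrite ge_max => /andP[ac bc]; split=> //.
  have Mc : M * `|w - (a - b)| <= c by lra.
  by rewrite -(ler_pM2l M0); apply: le_trans Mc _; rewrite /M divfK ?gt_eqF.
(* Taking [t = 0] bounds [f a - f b] by the larger norm, hence [|f| <= 1]; taking [t = 1],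
   [a = b = 0] gives [c <= f w], absurd since [|w| < c]. The slack in [m] makes [G] stable under
   sums. *)
pose G : set (sub_space W * R) := [set z | exists t a b m,
  [/\ 0 <= t, Wp a /\ Wp b, Num.max `|a| `|b| <= m &
    z = (t *: w - (a - b), t * c - m)]].
have [||||f _ fG] := @mazur_orlicz_dual R (sub_space W) M G.
- exact: ltW.
- exists 0, 0, 0, 0; split=> //; first by rewrite normr0 maxxx.
  by rewrite scale0r mul0r !subr0.
- move=> s _ _ _ _ s0 [t [a [b [m [t0 [Wa Wb] abm [-> ->]]]]]]
    [t' [a' [b' [m' [t'0 [Wa' Wb'] abm' [-> ->]]]]]].
  exists (s * t + t'), (s *: a + a'), (s *: b + b'), (s * m + m'); split.
  + by rewrite addr_ge0// mulr_ge0.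
  + by split; exact: WpD.
  + move: abm abm'; rewrite !ge_max => /andP[am bm] /andP[am' bm'].
    by apply/andP; split; apply: le_trans (ler_normD _ _) _;
      rewrite normrZ ger0_norm// lerD// ler_wpM2l.
  + congr (_, _); last by ring.
    rewrite scalerBr addrACA -opprD scalerA -scalerDl; congr (_ - _).
    by rewrite scalerBr opprD addrACA.
- move=> _ _ [t [a [b [m [t0 [Wa Wb] abm [-> ->]]]]]].
  have [->|tn0] := eqVneq t 0.
    rewrite mul0r sub0r; apply: (@le_trans _ _ 0); last by rewrite mulr_ge0// ltW.
    by rewrite oppr_le0; apply: le_trans abm; rewrite le_max normr_ge0.
  have ti0 : 0 <= t^-1 by rewrite invr_ge0.
  have -> : t *: w - (a - b) = t *: (w - (t^-1 *: a - t^-1 *: b)).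
    by rewrite -scalerBr [RHS]scalerBr scalerA divff// scale1r.
  rewrite normrZ ger0_norm//.
  have tab : t * Num.max `|t^-1 *: a| `|t^-1 *: b| = Num.max `|a| `|b|.
    by rewrite !normrZ (ger0_norm ti0) -maxr_pMr// mulrA divff// mul1r.
  have := cM _ _ (WpZ ti0 Wa) (WpZ ti0 Wb) => /(ler_wpM2l t0).
  rewrite [X in _ <= X -> _]mulrDr tab mulrCA lerBlDl => /le_trans; apply.
  by rewrite lerD2r.
have f1 : `|f| <= 1.
  apply: (dual_norm_le_cone oV LW ext) => // a b Wa Wb.
  have /fG : G (0 *: w - (a - b), 0 * c - Num.max `|a| `|b|).
    by exists 0, a, b, (Num.max `|a| `|b|); split.
  by rewrite scale0r mul0r !sub0r linearN lerN2 mul1r linearB.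
have /fG : G (1 *: w - (0 - 0), 1 * c - 0).
  by exists 1, 0, 0, 0; split=> //; rewrite normr0 maxxx.
rewrite scale1r mul1r !subr0 => cf.
have := ler_dual f w; have : `|f| * `|w| <= `|w| by rewrite ler_piMl.
by move=> fw wf; move: (le_trans cf (le_trans wf fw)); rewrite /c; lra.
Qed.

(* Completeness absorbs the error: subtracting approximate decompositions with
   errors [d n], halved at each step, leaves [x n --> 0]. *)
Lemma sub_cone_decomposition :
    (forall (w : sub_space W) (d : R), 0 < d -> exists a b,
      [/\ Wp a, Wp b, `|a| <= `|w| + d, `|b| <= `|w| + d & `|w - (a - b)| <= d]) ->
  order_smooth_oo2 Wp.
Proof.
(* The first term is at most [|w| + d 0], the later ones at most [d n + d n.+1 = 3 * d n.+1]; the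
   total is at most [|w| + 4 * d 0 = |w| + e / 2]. *)
move=> approx w e e0; pose e8 := e / 8; have e80 : 0 < e8 by rewrite divr_gt0.
pose d n : R := geometric e8 2^-1 n.
have d0 n : 0 < d n by rewrite /d /= mulr_gt0// exprn_gt0// invr_gt0.
have dS n : d n = 2 * d n.+1 by rewrite /d /= exprS mulrCA mulVKf.
(* The pair [(0, 0)] is a default for nonpositive tolerances; every [d n] is positive. *)
have /choice[ab abP] : forall z : sub_space W * R, exists ab : sub_space W * sub_space W,
    0 < z.2 -> [/\ Wp ab.1, Wp ab.2, `|ab.1| <= `|z.1| + z.2, `|ab.2| <= `|z.1| + z.2
      & `|z.1 - (ab.1 - ab.2)| <= z.2].
  move=> [x y]; have [y0|y0] := ltP 0 y; last by exists (0, 0).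
  by have [a [b abP]] := approx x y y0; exists (a, b).
pose x := fix x n := if n is m.+1 then
  x m - ((ab (x m, d m)).1 - (ab (x m, d m)).2) else w.
pose a n := (ab (x n, d n)).1; pose b n := (ab (x n, d n)).2.
have xS n : x n.+1 = x n - (a n - b n) by [].
have {abP} abP n : [/\ Wp (a n), Wp (b n), `|a n| <= `|x n| + d n,
    `|b n| <= `|x n| + d n & `|x n.+1| <= d n] by exact: (abP (x n, d n) (d0 n)).
have sum_le (u : nat -> sub_space W) : (forall n, `|u n| <= `|x n| + d n) ->
    forall n, \sum_(0 <= k < n) `|val (u k)| <= `|w| + e / 2.
  move=> u_le; have sum_le n : \sum_(0 <= k < n.+1) `|val (u k)| + 3 * d n <=
      `|w| + e / 2.
    elim: n => [|n IHn]; rewrite big_nat_recr//= -sub_space_normE.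
      by rewrite big_geq// add0r; have := u_le 0%N; rewrite /d /= /e8; lra.
    have [_ _ _ _ xn] := abP n; have := u_le n.+1; have := dS n; lra.
  case=> [|n]; last by have := sum_le n; have := d0 n; lra.
  by rewrite big_geq// addr_ge0// divr_ge0// ltW.
(* Limits are taken in the complete space [V]; the closed factor [W] keeps them in the subspace. *)
pose K := Vp `&` [set` W].
have KW u : Wp u -> K (val u) by move=> Wu; split=> //; exact: (valP u).
have clK : closed K by apply: closedI => //; exact: order_smooth_closed oV.
have coneK : cone K.
  move=> t y z t0 [Vy Wy] [Vz Wz]; split; first exact: (order_smooth_cone oV).
  by change (t *: y + z \in W); rewrite rpredD// rpredZ.
have K0 : K 0 := KW _ Wp0.
have [||a_inf [[Va Wa] a_inf_le cva]] :=
  @cvg_series_cone _ _ K (fun n => val (a n)) (`|w| + e / 2) clK coneK K0.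
- by move=> n; apply: KW; case: (abP n).
- by apply: sum_le => n; case: (abP n).
have [||b_inf [[Vb Wb] b_inf_le cvb]] :=
  @cvg_series_cone _ _ K (fun n => val (b n)) (`|w| + e / 2) clK coneK K0.
- by move=> n; apply: KW; case: (abP n).
- by apply: sum_le => n; case: (abP n).
exists (exist _ a_inf Wa), (exist _ b_inf Wb); split=> //; last first.
  rewrite !sub_space_normE /= gt_max; apply/andP.
  rewrite sub_space_normE in a_inf_le b_inf_le.
  by split; lra.
apply: val_inj => /=.
have cvx : val (x n) @[n --> \oo] --> (0 : V).
  rewrite -cvg_shiftS; apply/norm_cvg0P.
  apply: (@squeeze_cvgr _ _ _ _ (fun=> 0) d); last 2 first.
  - exact: cvg_cst.
  - by apply: cvg_geometric; rewrite gtr0_norm ?invr_gt0// invf_lt1// ltr1n.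
  by apply: nearW => n; rewrite normr_ge0 /=; case: (abP n).
(* The remainders telescope, so their limit is both [0] and [w - (a_inf - b_inf)]. *)
have xE n : val (x n) = val w - (series (fun n => val (a n)) n -
    series (fun n => val (b n)) n).
  elim: n => [|n IHn]; first by rewrite /series/= !big_geq// !subr0.
  rewrite xS !seriesSr /= IHn -addrA -opprD; congr (_ - _).
  by rewrite opprD [RHS]addrACA.
have cvx' : val (x n) @[n --> \oo] --> val w - (a_inf - b_inf).
  under eq_cvg do rewrite xE.
  by apply: cvgB; [exact: cvg_cst|exact: cvgB].
by apply/eqP; rewrite -subr_eq0; apply/eqP; exact: (cvg_unique _ cvx' cvx).
Qed.

(** Properness, closedness and the norm inequality restrict from [V]; generation is the
    decomposition with tolerance [1]. *)
Lemma sub_order_smooth : order_smooth_oo2 Wp -> order_smooth_oo_normed Wp.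
Proof.
move=> W2; split=> //.
- apply/seteqP; split=> [w [Ww [u Wu uw]]|_ ->]; last first.
    by split; [exact: Wp0|exists 0; [exact: Wp0|rewrite oppr0]].
  have : (Vp `&` -%R @` Vp) (val w).
    by split=> //; exists (val u); rewrite // -uw.
  by rewrite (order_smooth_proper oV) => w0; exact: val_inj.
- apply/seteqP; split=> // w _.
  by have [w1 [w2 [W1 W2' wE _]]] := W2 w 1 ltr01; exists w1, w2.
- apply: (iffLR (continuous_closedP _)); first exact: val_sub_space_continuous.
  exact: order_smooth_closed oV.
- by move=> u v w uv vw; exact: (order_smooth_le_max oV).
Qed.

End subspace_order_smooth.

(** * The cycle (i), (ii), (iii), (iv), (i) *)

Theorem theorem4p10 (R : realType) (V : completeNormedModType R) (Vp : set V)
    (W : submodClosed V) :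
  order_smooth_oo_normed Vp ->
  closed [set` W] ->
  M_ideal W ->
  [<-> order_smooth_oo_normed (sub_cone Vp : set (sub_space W));
       forall f : dual_space (sub_space W), dual_cone (sub_cone Vp) f ->
         exists2 g : dual_space V, dual_cone Vp g & dual_restr W g = f;
       annihilator_pi W @` dual_cone Vp =
         closure (annihilator_pi W @` dual_cone Vp : set (annihilator_quot W));
       forall f : dual_space (sub_space W), dual_cone (sub_cone Vp) f ->
         `|f| = sup [set (f w : R) | w in sub_cone Vp `&` [set w | `|w| <= 1]]].
Proof.
move=> oV clW [_ LW].
have V0 := proper_cone0 (order_smooth_proper oV).
have coneV := order_smooth_cone oV.
have closedP := closed_annihilator_pi_dual_coneP W coneV V0 (order_smooth_closed oV).
pose B := sub_cone Vp `&` [set w : sub_space W | `|w| <= 1].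
have fB_sup (f : dual_space (sub_space W)) : has_sup [set (f w : R) | w in B].
  split; first by exists (f 0), 0 => //; split; rewrite //= normr0.
  exists `|f| => _ [w [_ /= w1] <-]; apply: le_trans (ler_dual f w) _.
  by rewrite ler_piMr.
tfae.
- move=> oW; apply: dual_cone_extension => // f h f0 fh.
  exact: dual_cone_norm_le (order_smooth_decomposition oW) f0 fh.
- by move=> /closedP.
- move=> /closedP ext f f0; set s := sup _.
  have fs w : sub_cone Vp w -> f w <= s * `|w|.
    move=> Ww; have [->|w0] := eqVneq w 0; first by rewrite linear0 normr0 mulr0.
    have nw0 : 0 < `|w| by rewrite normr_gt0.
    rewrite -ler_pdivrMr// mulrC; apply: ub_le_sup; first exact: (fB_sup f).2.
    exists (`|w|^-1 *: w); last by rewrite linearZ.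
    split; last by rewrite /= normrZ normfV normr_id mulVf// gt_eqF.
    rewrite -[_ *: w]addr0.
    by apply: (coneV _ (val w) 0) => //; rewrite invr_ge0.
  have s0 : 0 <= s.
    apply: ub_le_sup; first exact: (fB_sup f).2.
    by exists 0; rewrite ?linear0//; split; rewrite //= normr0.
  apply/eqP; rewrite eq_le; apply/andP; split.
    (* As [f] is positive, [f a - f b <= f a <= s * |a|]. *)
    apply: (dual_norm_le_cone oV LW ext s0) => a b Wa Wb.
    apply: (@le_trans _ _ (f a)); first by rewrite gerBl; exact: f0.
    by apply: le_trans (fs _ Wa) _; rewrite ler_wpM2l// le_max lexx.
  apply: ge_sup; first exact: (fB_sup f).1.
  move=> _ [w [_ /= w1] <-]; apply: le_trans (ler_dual f w) _.
  by rewrite ler_piMr.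
- move=> norm_sup.
  have ext : forall f : dual_space (sub_space W), dual_cone (sub_cone Vp) f ->
      exists2 g, dual_cone Vp g & dual_restr W g = f.
    (* If [f <= h] on the cone, each value in the supremum giving [|f|] is at most [|h|]. *)
    apply: dual_cone_extension => // f h f0 fh; rewrite norm_sup//.
    apply: ge_sup; first exact: (fB_sup f).1.
    move=> _ [w [Ww /= w1] <-]; apply: le_trans (fh _ Ww) _.
    by apply: le_trans (ler_dual h w) _; rewrite ler_piMr.
  apply: sub_order_smooth => //; apply: sub_cone_decomposition => // w d d0.
  exact: (sub_cone_approximation oV w LW ext d0).
Qed.
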